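(* Let $M$ be a compact manifold without boundary of dimension $n\ge 3$. If $(g,V,c)$ is a Yamabe soliton on $M$, then $V$ is a geodesic vector field (i.e. $\Box V=0$) if and only if $M$ is of constant scalar curvature (with respect to $g$).
   Context: A Yamabe soliton $(g,V,c)$ on a manifold $M$ of dimension $n$ consists of a complete Riemannian metric $g$, a vector field $V$ (the soliton vector field) and a constant $c$ (the soliton constant) satisfying $\mathcal{L}_V g_{ij} = 2(-c+R)g_{ij}$, where $\mathcal{L}_V$ is the Lie derivative along $V$ and $R$ is the scalar curvature of $g$. A vector field $X$ on a Riemannian manifold is called a geodesic vector field if $\Box X=0$, where $\Box$ is the operator acting on smooth vector fields given in local coordinates by $\Box X^i = -(g^{jk}\nabla_j\nabla_k X^i + R^i_j X^j)$. Here $\nabla$ is the Levi-Civita connection of $g$ and $R^i_j=g^{ik}R_{kj}$ is the Ricci tensor with one index raised (usual sign convention: the Ricci tensor of the round sphere is positive). *)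

(* Defs.v *)
From HB Require Import structures.
From mathcomp Require Import all_boot all_order all_algebra.
From mathcomp Require Import all_classical all_reals all_analysis.

Set Implicit Arguments.
Unset Strict Implicit.
Unset Printing Implicit Defensive.

Import Order.TTheory GRing.Theory Num.Theory.
Import numFieldNormedType.Exports.

Local Open Scope classical_set_scope.
Local Open Scope ring_scope.

Definition basis_vec (R : realType) (n : nat) (i : 'I_n) : 'rV[R]_n :=
  delta_mx 0 i.

Definition partial (R : realType) (n : nat) (i : 'I_n) (f : 'rV[R]_n -> R)
    (x : 'rV[R]_n) : R :=
  'D_(basis_vec R i) f x.

(** C^k on an open set [U]; the values of [f] outside [U] are irrelevant. *)
Fixpoint Ck_on (R : realType) (n : nat) (k : nat) (U : set 'rV[R]_n)
    (f : 'rV[R]_n -> R) : Prop :=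
  (forall x, U x -> {for x, continuous f}) /\
  match k with
  | 0%N => True
  | k'.+1 => forall i : 'I_n,
      (forall x, U x -> derivable f x (basis_vec R i)) /\
      Ck_on k' U (partial i f)
  end.

Definition smooth_on (R : realType) (n : nat) (U : set 'rV[R]_n)
    (f : 'rV[R]_n -> R) : Prop :=
  forall k, Ck_on k U f.

(** [coord] is a homeomorphism from the open set [dom] onto an open subset of
    R^n, with inverse [param]; both are total functions that only matter on
    [dom] and on its image. *)
Record chart (R : realType) (n : nat) (M : topologicalType) := Chart {
  dom : set M;
  coord : M -> 'rV[R]_n;
  param : 'rV[R]_n -> M;
  dom_open : open dom;
  img_open : open (coord @` dom);
  coordK : forall p, dom p -> param (coord p) = p;
  coord_cont : forall p, dom p -> {for p, continuous coord};
  param_cont : forall x, (coord @` dom) x -> {for x, continuous param}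
}.

Definition img (R : realType) (n : nat) (M : topologicalType)
    (a : chart R n M) : set 'rV[R]_n :=
  coord a @` dom a.

(** Domain, in the coordinates of [a], of the coordinate change to [b]. *)
Definition overlap (R : realType) (n : nat) (M : topologicalType)
    (a b : chart R n M) : set 'rV[R]_n :=
  coord a @` (dom a `&` dom b).

Definition transition (R : realType) (n : nat) (M : topologicalType)
    (a b : chart R n M) (x : 'rV[R]_n) : 'rV[R]_n :=
  coord b (param a x).

(** Smooth manifolds without boundary, since charts have open images in R^n;
    connectedness is not required. *)
Record manifold (R : realType) (n : nat) := Manifold {
  points :> topologicalType;
  chart_index : Type;
  atlas : chart_index -> chart R n points;
  manifold_hausdorff : hausdorff_space points;
  manifold_second_countable : @second_countable points;
  atlas_cover : forall p : points, exists a, dom (atlas a) p;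
  atlas_smooth : forall (a b : chart_index) (k : 'I_n),
    smooth_on (overlap (atlas a) (atlas b))
              (fun x => transition (atlas a) (atlas b) x 0 k)
}.

Arguments chart_index {R n} m.
Arguments atlas {R n} m _.

(** Entry [(i, k)] is d_i y^k, where y = y(x) is the coordinate change from
    [a] to [b]. *)
Definition change_mx (R : realType) (n : nat) (M : manifold R n)
    (a b : chart_index M) (x : 'rV[R]_n) : 'M[R]_n :=
  \matrix_(i, k) partial i (fun y => transition (atlas M a) (atlas M b) y 0 k) x.

(** Tensor fields are given by their components in each chart of the atlas, as
    functions of the coordinates, subject to the transformation law. *)
Record vector_field (R : realType) (n : nat) (M : manifold R n) :=
  VectorField {
  vf :> chart_index M -> 'rV[R]_n -> 'rV[R]_n;
  vf_smooth : forall a i,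
    smooth_on (img (atlas M a)) (fun x => vf a x 0 i);
  vf_change : forall a b x, overlap (atlas M a) (atlas M b) x -> forall k,
    vf b (transition (atlas M a) (atlas M b) x) 0 k =
    \sum_i change_mx a b x i k * vf a x 0 i
}.

Record riemannian_metric (R : realType) (n : nat) (M : manifold R n) :=
  RiemannianMetric {
  met :> chart_index M -> 'rV[R]_n -> 'M[R]_n;
  met_smooth : forall a i j,
    smooth_on (img (atlas M a)) (fun x => met a x i j);
  met_sym : forall a x, img (atlas M a) x -> forall i j,
    met a x i j = met a x j i;
  met_posdef : forall a x, img (atlas M a) x -> forall v : 'rV[R]_n,
    v != 0 -> 0 < \sum_i \sum_j met a x i j * v 0 i * v 0 j;
  met_change : forall a b x, overlap (atlas M a) (atlas M b) x -> forall i j,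
    met a x i j =
    \sum_k \sum_l change_mx a b x i k * change_mx a b x j l *
      met b (transition (atlas M a) (atlas M b) x) k l
}.

(** From here to [lie_metric], [g] and [X] are the components of a metric and of
    a vector field in one chart; [gup g i j] is g^{ij}. *)
Definition gup (R : realType) (n : nat) (g : 'rV[R]_n -> 'M[R]_n)
    (i j : 'I_n) (x : 'rV[R]_n) : R :=
  invmx (g x) i j.

(** Gamma^k_{ij}, for the Levi-Civita connection. *)
Definition christoffel (R : realType) (n : nat) (g : 'rV[R]_n -> 'M[R]_n)
    (k i j : 'I_n) (x : 'rV[R]_n) : R :=
  2^-1 * \sum_l gup g k l x *
    (partial i (fun y => g y j l) x + partial j (fun y => g y i l) x
     - partial l (fun y => g y i j) x).

(** R_{jk} = d_i Gamma^i_{jk} - d_j Gamma^i_{ik}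
             + Gamma^i_{il} Gamma^l_{jk} - Gamma^i_{jl} Gamma^l_{ik},
    which is positive on round spheres. *)
Definition ricci (R : realType) (n : nat) (g : 'rV[R]_n -> 'M[R]_n)
    (j k : 'I_n) (x : 'rV[R]_n) : R :=
  \sum_i (partial i (christoffel g i j k) x - partial j (christoffel g i i k) x)
  + \sum_i \sum_l (christoffel g i i l x * christoffel g l j k x
                   - christoffel g i j l x * christoffel g l i k x).

(** R^i_j = g^{ik} R_{kj} *)
Definition ricci_up (R : realType) (n : nat) (g : 'rV[R]_n -> 'M[R]_n)
    (i j : 'I_n) (x : 'rV[R]_n) : R :=
  \sum_k gup g i k x * ricci g k j x.

Definition scalar_curvature (R : realType) (n : nat)
    (g : 'rV[R]_n -> 'M[R]_n) (x : 'rV[R]_n) : R :=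
  \sum_i \sum_j gup g i j x * ricci g i j x.

(** nabla_k X^i *)
Definition nabla (R : realType) (n : nat) (g : 'rV[R]_n -> 'M[R]_n)
    (X : 'rV[R]_n -> 'rV[R]_n) (k i : 'I_n) (x : 'rV[R]_n) : R :=
  partial k (fun y => X y 0 i) x + \sum_l christoffel g i k l x * X x 0 l.

(** nabla_j nabla_k X^i: the covariant derivative of the (1,1)-tensor
    nabla_k X^i. *)
Definition nabla2 (R : realType) (n : nat) (g : 'rV[R]_n -> 'M[R]_n)
    (X : 'rV[R]_n -> 'rV[R]_n) (j k i : 'I_n) (x : 'rV[R]_n) : R :=
  partial j (nabla g X k i) x
  + \sum_l christoffel g i j l x * nabla g X k l x
  - \sum_l christoffel g l j k x * nabla g X l i x.

Definition box (R : realType) (n : nat) (g : 'rV[R]_n -> 'M[R]_n)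
    (X : 'rV[R]_n -> 'rV[R]_n) (i : 'I_n) (x : 'rV[R]_n) : R :=
  - (\sum_j \sum_k gup g j k x * nabla2 g X j k i x
     + \sum_j ricci_up g i j x * X x 0 j).

(** (L_X g)_{ij} = X^k d_k g_{ij} + g_{kj} d_i X^k + g_{ik} d_j X^k *)
Definition lie_metric (R : realType) (n : nat) (g : 'rV[R]_n -> 'M[R]_n)
    (X : 'rV[R]_n -> 'rV[R]_n) (i j : 'I_n) (x : 'rV[R]_n) : R :=
  \sum_k (X x 0 k * partial k (fun y => g y i j) x
          + g x k j * partial i (fun y => X y 0 k) x
          + g x i k * partial j (fun y => X y 0 k) x).

(** The [k]-th coordinate of the curve [gam] in the chart [a]. *)
Definition curve_coord (R : realType) (n : nat) (M : manifold R n)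
    (a : chart_index M) (gam : R -> M) (k : 'I_n) (s : R) : R :=
  coord (atlas M a) (gam s) 0 k.

Definition is_geodesic (R : realType) (n : nat) (M : manifold R n)
    (g : riemannian_metric M) (gam : R -> M) : Prop :=
  continuous gam /\
  forall (a : chart_index M) (t : R), dom (atlas M a) (gam t) -> forall k : 'I_n,
    let u := curve_coord a gam in
    [/\ derivable (u k) t 1,
        derivable (derive1 (u k)) t 1 &
        derive1 (derive1 (u k)) t
        + \sum_i \sum_j christoffel (g a) k i j (coord (atlas M a) (gam t))
            * derive1 (u i) t * derive1 (u j) t = 0].

(** Geodesic completeness: every initial point and velocity belong to a
    geodesic defined on all of R. *)
Definition complete_metric (R : realType) (n : nat) (M : manifold R n)
    (g : riemannian_metric M) : Prop :=
  forall (a : chart_index M) (p : M) (v : 'rV[R]_n), dom (atlas M a) p ->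
  exists gam : R -> M,
    [/\ is_geodesic g gam, gam 0 = p &
        forall k, derive1 (curve_coord a gam k) 0 = v 0 k].

Definition yamabe_soliton (R : realType) (n : nat) (M : manifold R n)
    (g : riemannian_metric M) (V : vector_field M) (c : R) : Prop :=
  complete_metric g /\
  forall (a : chart_index M) (x : 'rV[R]_n), img (atlas M a) x -> forall i j : 'I_n,
    lie_metric (g a) (V a) i j x
    = 2 * (- c + scalar_curvature (g a) x) * g a x i j.

Definition geodesic_vector_field (R : realType) (n : nat) (M : manifold R n)
    (g : riemannian_metric M) (X : vector_field M) : Prop :=
  forall (a : chart_index M) (x : 'rV[R]_n), img (atlas M a) x -> forall i : 'I_n,
    box (g a) (X a) i x = 0.

Definition constant_scalar_curvature (R : realType) (n : nat)
    (M : manifold R n) (g : riemannian_metric M) : Prop :=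
  exists k : R, forall (a : chart_index M) (x : 'rV[R]_n), img (atlas M a) x ->
    scalar_curvature (g a) x = k.

(* Main.v *)
From HB Require Import structures.
Require Import Defs.
From mathcomp Require Import all_boot all_order all_algebra.
From mathcomp Require Import all_classical all_reals all_analysis.
From mathcomp Require Import ring lra.

(** Write [rho = R - c], so that the soliton equation reads [L_V g = 2 rho g]:
    [V] is a conformal field with factor [rho].

    In every chart such a field satisfies [box V = (n - 2) grad rho]
    ([box_conformal]). Indeed [nabla_i V_j + nabla_j V_i = 2 rho g_ij];
    differentiating once more and contracting gives
    [Laplacian V_j + nabla^i nabla_j V_i = 2 d_j rho], and exchanging the two
    derivatives in the second term turns it into [d_j (div V) + R_jk V^k], where
    [div V = n rho]. Since [n] is not 2, [V] is a geodesic field iff the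
    differential of [R] vanishes. This settles the implication from constant
    scalar curvature, and conversely shows that [R], hence [rho], is locally
    constant.

    As [M] may be disconnected, it remains to compare the values of [R] on
    different components, and in fact [rho = 0] ([conformal_factor_eq0]).
    Contracting the soliton equation twice with [V] gives
    [V(|V|^2) = 2 rho |V|^2]. The set where [rho] is nonzero is open and closed,
    hence compact. At a point of it where [|V|^2] is maximal the left-hand side
    vanishes, so [V] vanishes on the whole set; but then [rho] vanishes there as
    well, and the set is empty. Thus [R = c] everywhere.

    The last argument uses [rho] as a function on [M]. That its values in
    different charts agree is read off from the same identity, because [|V|^2] and
    [V(|V|^2)] only involve the first-order transformation laws of [V] and [g]
    ([factor_change]). *)

Set Implicit Arguments.
Unset Strict Implicit.
Unset Printing Implicit Defensive.
Import Order.TTheory GRing.Theory Num.Theory.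
Import numFieldNormedType.Exports.
Local Open Scope classical_set_scope.
Local Open Scope ring_scope.

(** * Differential calculus in several variables *)

Lemma is_derive_line (R : realType) (E F : normedModType R) (f : E -> F) (y v : E) (t : R) :
  derivable f (y + t *: v) v ->
  is_derive t 1 (fun s : R => f (y + s *: v)) ('D_v f (y + t *: v)).
Proof.
have lineE : (fun h : R => h^-1 *: (((fun s : R => f (y + s *: v)) \o shift t) (h *: (1:R))
                 - f (y + t *: v)))
  = (fun h => h^-1 *: ((f \o shift (y + t *: v)) (h *: v) - f (y + t *: v))).
  apply/funext => h /=; congr (_ *: (f _ - _)).
  by rewrite scalerDl addrCA /GRing.scale/= mulr1.
by move=> dfv; split; rewrite /derivable /derive lineE.
Qed.

(** Allowing [h] of either sign, and only asking for the directional derivative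
    along the segment, is what the telescoping arguments below need. *)
Lemma line_MVT (R : realType) (E : normedModType R) (f : E -> R) (y v : E) (h : R) :
  (forall t : R, `|t| <= `|h| -> derivable f (y + t *: v) v) ->
  exists2 t, `|t| <= `|h| & f (y + h *: v) - f y = h * 'D_v f (y + t *: v).
Proof.
move=> dfv; pose phi (s : R) := f (y + s *: v).
have dphi (t : R) : `|t| <= `|h| -> is_derive t 1 phi ('D_v f (y + t *: v)).
  by move=> /dfv; exact: is_derive_line.
have cphi (a b : R) : `|a| <= `|h| -> `|b| <= `|h| -> {within `[a, b], continuous phi}.
  move=> ah bh; apply: derivable_within_continuous => t /itvP tab.
  have /dphi[//] : `|t| <= `|h|.
  move: ah bh; rewrite !ler_norml => /andP[ha _] /andP[_ hb].
  by rewrite (le_trans ha) ?tab// (le_trans _ hb) ?tab.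
have [h0|h0] := leP 0 h.
- have [t|t|t /itvP th E0] := @MVT_segment _ phi (fun t => 'D_v f (y + t *: v)) _ _ h0.
  + by move=> /itvP th; apply: dphi; rewrite !ger0_norm ?th.
  + by apply: cphi; rewrite ?normr0.
  + exists t; first by rewrite !ger0_norm ?th.
    by move: E0; rewrite /phi scale0r addr0 subr0 mulrC.
- have [t|t|t /itvP th E0] := @MVT_segment _ phi (fun t => 'D_v f (y + t *: v)) _ _ (ltW h0).
  + by move=> /itvP th; apply: dphi; rewrite !ler0_norm ?(ltW h0) ?th// lerN2 th.
  + by apply: cphi; rewrite ?normr0.
  + exists t; first by rewrite !ler0_norm ?(ltW h0) ?th// lerN2 th.
    move: E0; rewrite /phi scale0r addr0 sub0r mulrN => E0.
    by apply: oppr_inj; rewrite opprB E0 mulrC.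
Qed.

Lemma mx_norm_le (R : realType) (n : nat) (v : 'rV[R]_n) (r : R) :
  0 <= r -> (forall i, `|v 0 i| <= r) -> `|v| <= r.
Proof.
move=> r0 vr; rewrite [leLHS]/Num.Def.normr/= mx_normrE.
by apply: bigmax_le => // -[i j] _ /=; rewrite ord1.
Qed.

Lemma ler_coord_norm (R : realType) (n : nat) (v : 'rV[R]_n) i : `|v 0 i| <= `|v|.
Proof.
rewrite [leRHS]/Num.Def.normr/= mx_normrE.
exact: (le_bigmax _ (fun ij => `|v ij.1 ij.2|) (0, i)).
Qed.

(** The corners of the coordinate path that leads from 0 to [v] by moving along
    one axis at a time. *)
Definition truncate (R : realType) (n : nat) (v : 'rV[R]_n) (k : nat) : 'rV[R]_n :=
  \row_i (if (i < k)%N then v 0 i else 0).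

Lemma truncate0 (R : realType) (n : nat) (v : 'rV[R]_n) : truncate v 0 = 0.
Proof. by apply/rowP => i; rewrite !mxE. Qed.

Lemma truncate_full (R : realType) (n : nat) (v : 'rV[R]_n) : truncate v n = v.
Proof. by apply/rowP => i; rewrite !mxE ltn_ord. Qed.

Lemma truncateS (R : realType) (n : nat) (v : 'rV[R]_n) (k : 'I_n) :
  truncate v k.+1 = truncate v k + v 0 k *: basis_vec R k.
Proof.
apply/rowP => i; rewrite !mxE eqxx ltnS eq_sym /=.
have [<-|ik] := eqVneq k i; first by rewrite leqnn ltnn mulr1 add0r.
by rewrite mulr0 addr0 leq_eqVlt -[_ == _ :> nat]/(i == k) eq_sym (negPf ik).
Qed.

(** The norm on row vectors is the sup norm, so its balls are cubes and contain
    every coordinate path that ends in them. *)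
Lemma norm_truncate (R : realType) (n : nat) (v : 'rV[R]_n) (k : 'I_n) (t : R) :
  `|t| <= `|v 0 k| -> `|truncate v k + t *: basis_vec R k| <= `|v|.
Proof.
move=> tv; apply: mx_norm_le => // i; rewrite !mxE eqxx /=.
have [->|ik] := eqVneq i k.
  by rewrite ltnn add0r mulr1 (le_trans tv)// ler_coord_norm.
by rewrite mulr0 addr0; case: ifP => _; rewrite ?normr0// ler_coord_norm.
Qed.

Definition gradient_form (R : realType) (n : nat) (f : 'rV[R]_n -> R) (x h : 'rV[R]_n) : R :=
  \sum_i h 0 i * partial i f x.

Fact gradient_form_linear (R : realType) (n : nat) (f : 'rV[R]_n -> R) (x : 'rV[R]_n) :
  linear (gradient_form f x).
Proof.
move=> a u v; rewrite /gradient_form scaler_sumr -big_split /=.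
by apply: eq_bigr => i _; rewrite !mxE mulrDl scalerAl.
Qed.

HB.instance Definition _ (R : realType) (n : nat) (f : 'rV[R]_n -> R) (x : 'rV[R]_n) :=
  GRing.isLinear.Build R 'rV[R]_n R _ (gradient_form f x) (gradient_form_linear f x).

Lemma gradient_form_continuous (R : realType) (n : nat) (f : 'rV[R]_n -> R) (x : 'rV[R]_n) :
  continuous (gradient_form f x).
Proof.
move=> h; apply: differentiable_continuous.
have -> : gradient_form f x = \sum_i ((fun h : 'rV[R]_n => h 0 i) * cst (partial i f x)).
  by apply/funext => v; rewrite fct_sumE.
by apply: differentiable_sum => i; apply: differentiableM => //; exact: differentiable_coord.
Qed.

Lemma diff_gradient (R : realType) (n : nat) (f : 'rV[R]_n -> R) (x : 'rV[R]_n) :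
  differentiable f x -> 'd f x = gradient_form f x :> (_ -> _).
Proof.
move=> df; apply/funext => v; rewrite [in LHS](row_sum_delta v) linear_sum /=.
by apply: eq_bigr => k _; rewrite linearZ /= -deriveE.
Qed.

Lemma differentiable_small_remainder (R : realType) (V W : normedModType R)
    (f : V -> W) (df : {linear V -> W}) (x : V) :
  continuous df ->
  (forall e : R, 0 < e ->
     \forall h \near (0 : V), `|f (h + x) - f x - df h| <= e * `|h|) ->
  differentiable f x.
Proof.
move=> cdf small; suff fE : f \o shift x = cst (f x) + df +o_ 0 id.
  have dfE := diff_unique cdf fE.
  by apply/diff_locallyP; rewrite dfE.
apply/eqaddoP => e e0; near=> h.
rewrite [X in `|X|](_ : _ = f (h + x) - f x - df h).
  by near: h; exact: small.
by rewrite /= !fctE opprD addrA.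
Unshelve. all: by end_near. Qed.

(** Along the coordinate path from [x] to [x + h] the increment of [f]
    telescopes; by the mean value theorem each step contributes [h_k] times a
    value of the [k]-th partial derivative near [x], which continuity replaces
    by its value at [x] up to an arbitrarily small multiple of the norm of [h]. *)
Lemma C1_differentiable (R : realType) (n : nat) (U : set 'rV[R]_n)
    (f : 'rV[R]_n -> R) (x : 'rV[R]_n) :
  open U -> U x ->
  (forall i y, U y -> derivable f y (basis_vec R i)) ->
  (forall i, {for x, continuous (partial i f)}) ->
  differentiable f x.
Proof.
move=> oU Ux df cf.
apply: (@differentiable_small_remainder R 'rV[R]_n R f (gradient_form f x)).
  exact: gradient_form_continuous.
move=> e e0.
(* There are [n] steps; [n.+1] avoids dividing by zero when [n = 0]. *)
have e'0 : 0 < e / n.+1%:R by rewrite divr_gt0.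
have : \forall y \near x, U y /\ forall i, `|partial i f x - partial i f y| <= e / n.+1%:R.
  near=> y; split; first by near: y; exact: open_nbhs_nbhs.
  near: y; apply: filter_forall => i.
  exact: (cvgrPdist_le _ _).1 (cf i) _ e'0.
move=> /nbhs_ballP[d /= d0 dP].
near=> h.
have hd : `|h| < d.
  near: h; apply/nbhs_ballP; exists d => // h.
  by rewrite -ball_normE /ball_/= sub0r normrN.
have inb v : `|v| <= `|h| ->
    U (x + v) /\ forall i, `|partial i f x - partial i f (x + v)| <= e / n.+1%:R.
  move=> vh; apply: dP; rewrite -ball_normE /ball_/= opprD addNKr normrN.
  exact: le_lt_trans hd.
rewrite [X in `|X|](_ : _ = \sum_(k < n)
  (f (x + truncate h k.+1) - f (x + truncate h k) - h 0 k * partial k f x)); last first.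
  rewrite sumrB -(big_mkord xpredT (fun k => f (x + truncate h k.+1) - f (x + truncate h k))).
  rewrite (telescope_sumr (fun k => f (x + truncate h k)))//.
  by rewrite truncate0 truncate_full addr0 [x + h]addrC -addrA -opprD.
apply: (@le_trans _ _ (\sum_(k < n) (e / n.+1%:R * `|h|))).
  apply: (le_trans (ler_norm_sum _ _ _)); apply: ler_sum => k _.
  have [t th|t th] := @line_MVT _ _ f (x + truncate h k) (basis_vec R k) (h 0 k) _.
    by apply: df; rewrite -addrA; have [] := inb _ (norm_truncate th).
  rewrite truncateS addrA => ->.
  rewrite -addrA -mulrBr normrM mulrC ler_pM// ?ler_coord_norm//.
  by rewrite distrC; have [_] := inb _ (norm_truncate th); exact.
rewrite sumr_const card_ord -[leLHS]mulr_natl mulrA ler_wpM2r// mulrCA ger_pMr//.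
by rewrite ler_pdivrMr// mul1r ler_nat.
Unshelve. all: by end_near. Qed.

Lemma smooth_on_continuous (R : realType) (n : nat) (U : set 'rV[R]_n) f :
  smooth_on U f -> forall x, U x -> {for x, continuous f}.
Proof. by move=> /(_ 0%N)[]. Qed.

Lemma smooth_on_derivable (R : realType) (n : nat) (U : set 'rV[R]_n) f :
  smooth_on U f -> forall i x, U x -> derivable f x (basis_vec R i).
Proof. by move=> /(_ 1%N)[_ + i] => /(_ i)[]. Qed.

Lemma smooth_on_partial (R : realType) (n : nat) (U : set 'rV[R]_n) f :
  smooth_on U f -> forall i, smooth_on U (partial i f).
Proof. by move=> sf i k; have [_ /(_ i)[]] := sf k.+1. Qed.

Lemma smooth_on_differentiable (R : realType) (n : nat) (U : set 'rV[R]_n) f :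
  open U -> smooth_on U f -> forall x, U x -> differentiable f x.
Proof.
move=> oU sf x Ux; apply: (C1_differentiable oU Ux); first exact: smooth_on_derivable.
by move=> i; apply: smooth_on_continuous Ux; exact: smooth_on_partial.
Qed.

Lemma near_dist_le (R : realType) (V : normedModType R) (f : V -> R) (x : V) (e : R) :
  {for x, continuous f} -> 0 < e -> \forall y \near x, `|f x - f y| <= e.
Proof. by move=> cf e0; exact: (cvgrPdist_le _ _).1 cf _ e0. Qed.

(** The vanishing partial derivatives are continuous, hence [f] is
    differentiable with zero differential, and the mean value theorem applies on
    the segments of a ball. *)
Lemma partial0_locally_constant (R : realType) (n : nat) (U : set 'rV[R]_n)
    (f : 'rV[R]_n -> R) (x : 'rV[R]_n) :
  open U -> U x ->
  (forall i y, U y -> derivable f y (basis_vec R i)) ->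
  (forall i y, U y -> partial i f y = 0) ->
  \forall y \near x, f y = f x.
Proof.
move=> oU Ux df f0.
have cf i y : U y -> {for y, continuous (partial i f)}.
  move=> Uy; apply: (near_cst_continuous 0).
  by near=> z; apply: f0; near: z; exact: open_nbhs_nbhs.
have Df v y : U y -> derivable f y v /\ 'D_v f y = 0.
  move=> Uy; have dfy := C1_differentiable oU Uy df (fun i => cf i y Uy).
  split; first exact: diff_derivable.
  rewrite deriveE// diff_gradient// /gradient_form big1// => i _.
  by rewrite f0 ?mulr0.
have /nbhs_ballP[d /= d0 dU] : nbhs x U by exact: open_nbhs_nbhs.
apply/nbhs_ballP; exists d => // y xy.
have inU (t : R) : `|t| <= `|1 : R| -> U (x + t *: (y - x)).
  rewrite normr1 => t1; apply: dU; move: xy; rewrite -ball_normE /ball_/= opprD addNKr normrN.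
  by rewrite normrZ distrC; apply: le_lt_trans; rewrite ler_piMl.
have [t /inU/(Df (y - x))[]//|t /inU/(Df (y - x))[_ ->]] :=
  @line_MVT _ _ f x (y - x) 1.
by rewrite mulr0 scale1r subrKC => /subr0_eq.
Unshelve. all: by end_near. Qed.

Lemma derivable_shift (R : realType) (V W : normedModType R) (f : V -> W) (a x v : V) :
  derivable f (x + a) v ->
  derivable (fun y => f (y + a)) x v /\ 'D_v (fun y => f (y + a)) x = 'D_v f (x + a).
Proof.
have E : (fun h : R => h^-1 *: (((fun y => f (y + a)) \o shift x) (h *: v) - f (x + a)))
  = (fun h : R => h^-1 *: ((f \o shift (x + a)) (h *: v) - f (x + a))).
  by apply/funext => h /=; rewrite addrA.
by rewrite /derivable /derive E.
Qed.

Definition second_difference (R : realType) (V : normedModType R)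
    (f : V -> R) (u v x : V) : R :=
  (f (x + u + v) - f (x + u)) - (f (x + v) - f x).

(** The mean value theorem, applied first to the increment of [f] in direction
    [j] as a function of the direction [i], then to [partial i f]. *)
Lemma second_difference_MVT (R : realType) (n : nat) (f : 'rV[R]_n -> R) (i j : 'I_n)
    (x : 'rV[R]_n) (h : R) :
  (forall s t : R, `|s| <= `|h| -> `|t| <= `|h| ->
     derivable f (x + s *: basis_vec R i + t *: basis_vec R j) (basis_vec R i)) ->
  (forall s t : R, `|s| <= `|h| -> `|t| <= `|h| ->
     derivable (partial i f) (x + s *: basis_vec R i + t *: basis_vec R j) (basis_vec R j)) ->
  exists s t, [/\ `|s| <= `|h|, `|t| <= `|h| &
    second_difference f (h *: basis_vec R i) (h *: basis_vec R j) x =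
    h * h * partial j (partial i f) (x + s *: basis_vec R i + t *: basis_vec R j)].
Proof.
move=> df ddf; pose phi y := f (y + h *: basis_vec R j) - f y.
have h0 : `|0 : R| <= `|h| by rewrite normr0.
have dphi (s : R) : `|s| <= `|h| -> derivable phi (x + s *: basis_vec R i) (basis_vec R i) /\
    'D_(basis_vec R i) phi (x + s *: basis_vec R i) =
    partial i f (x + s *: basis_vec R i + h *: basis_vec R j)
    - partial i f (x + s *: basis_vec R i).
  move=> sh; have [d1 E1] := derivable_shift (df s h sh (lexx _)).
  have d2 := df s 0 sh h0; rewrite scale0r addr0 in d2.
  by split; [exact: derivableB d1 d2|rewrite (deriveB d1 d2) E1].
have [t /dphi[]//|s sh Es] := @line_MVT _ _ phi x (basis_vec R i) h.
have [t th|t th Et] := @line_MVT _ _ (partial i f) (x + s *: basis_vec R i) (basis_vec R j) h.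
  exact: ddf.
exists s, t; split => //; rewrite -mulrA -Et.
by have [_ <-] := dphi _ sh.
Qed.

Lemma ler_dist_half (R : realType) (a b m e : R) :
  `|b - m| <= e / 2 -> `|a - m| <= e / 2 -> `|a - b| <= e.
Proof.
move=> bm am; rewrite [leRHS]splitr (le_trans (ler_distD m _ _))// lerD//.
by rewrite distrC.
Qed.

(** The second difference is symmetric in the two directions; evaluating it in
    both orders equates values of the two mixed derivatives at points that tend
    to [x]. *)
Lemma Schwarz (R : realType) (n : nat) (U : set 'rV[R]_n) (f : 'rV[R]_n -> R) (i j : 'I_n) :
  open U -> smooth_on U f -> forall x, U x ->
  partial i (partial j f) x = partial j (partial i f) x.
Proof.
move=> oU sf x Ux; apply/subr0_eq/normr0_eq0/eqP; rewrite eq_le normr_ge0 andbT.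
apply/ler_addgt0Pl => e e0; rewrite addr0.
have e20 : 0 < e / 2 by rewrite divr_gt0.
have cont k l : {for x, continuous (partial k (partial l f))}.
  by apply: smooth_on_continuous Ux; do 2!apply: smooth_on_partial.
have : \forall y \near x, [/\ U y,
    `|partial i (partial j f) x - partial i (partial j f) y| <= e / 2 &
    `|partial j (partial i f) x - partial j (partial i f) y| <= e / 2].
  have := open_nbhs_nbhs (conj oU Ux).
  by apply: filterS3 (near_dist_le (cont i j) e20) (near_dist_le (cont j i) e20) => y.
move=> /nbhs_ballP[d /= d0 dP].
(* The points in play have the form [x + s e_k + t e_l] with [s] and [t] at most
   [h]; the triangle inequality puts them within [2 h < d] of [x]. *)
pose h := d / 3.
have h0 : 0 < h by rewrite divr_gt0.
have dP' (k l : 'I_n) (s t : R) : `|s| <= `|h| -> `|t| <= `|h| ->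
    ball x d (x + s *: basis_vec R k + t *: basis_vec R l).
  move=> sh th; rewrite -ball_normE /ball_/= -addrA opprD addNKr normrN.
  have e1 m : `|basis_vec R m| <= 1.
    by apply: mx_norm_le => // p; rewrite mxE; case: (_ && _); rewrite ?normr1 ?normr0.
  apply: (@le_lt_trans _ _ (h + h)); last by rewrite /h; lra.
  apply: (le_trans (ler_normD _ _)); rewrite !normrZ.
  rewrite (gtr0_norm h0) in sh th.
  by apply: lerD; rewrite -[leRHS]mulr1; apply: ler_pM => //; exact: e1.
have inU k l s t (sh : `|s| <= `|h|) (th : `|t| <= `|h|) :
    U (x + s *: basis_vec R k + t *: basis_vec R l).
  by have [] := dP _ (dP' k l _ _ sh th).
have MVTh k l := @second_difference_MVT R n f k l x h
  (fun s t sh th => @smooth_on_derivable R n U f sf k _ (inU k l s t sh th))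
  (fun s t sh th => @smooth_on_derivable R n U _ (smooth_on_partial sf k) l _ (inU k l s t sh th)).
have [s1 [t1 [s1h t1h E1]]] := MVTh i j.
have [s2 [t2 [s2h t2h E2]]] := MVTh j i.
have sym : second_difference f (h *: basis_vec R i) (h *: basis_vec R j) x =
    second_difference f (h *: basis_vec R j) (h *: basis_vec R i) x.
  by rewrite /second_difference [x + _ + _ in RHS]addrAC; ring.
have hh : h * h != 0 by rewrite mulf_neq0 ?gt_eqF.
have := sym; rewrite E1 E2 => /(mulfI hh) E.
have [_ _ b1] := dP _ (dP' i j _ _ s1h t1h).
have [_ b2 _] := dP _ (dP' j i _ _ s2h t2h).
rewrite -E in b2.
exact: ler_dist_half b1 b2.
Qed.

Lemma row_differentiable (R : realType) (V : normedModType R) (n : nat)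
    (T : V -> 'rV[R]_n) (x : V) :
  (forall k, differentiable (fun y => T y 0 k) x) -> differentiable T x.
Proof.
move=> dT.
have -> : T = \sum_k (fun y => T y 0 k *: delta_mx 0 k : 'rV[R]_n).
  by apply/funext => y; rewrite fct_sumE; exact: row_sum_delta.
by apply: differentiable_sum => k; apply: differentiableZl.
Qed.

Lemma partial_comp (R : realType) (m n : nat)
    (T : 'rV[R]_m -> 'rV[R]_n) (f : 'rV[R]_n -> R) (x : 'rV[R]_m) :
  (forall k, differentiable (fun y => T y 0 k) x) -> differentiable f (T x) ->
  forall i, partial i (fun y => f (T y)) x =
  \sum_k partial i (fun y => T y 0 k) x * partial k f (T x).
Proof.
move=> /row_differentiable dT df i.
have dfT : differentiable (f \o T) x by exact: differentiable_comp.
have TE := derive_mx (@diff_derivable R 'rV[R]_m 'rV[R]_n T x (basis_vec R i) dT).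
rewrite /partial -[fun y => f (T y)]/(f \o T) (deriveE _ dfT) diff_comp//.
rewrite /= (diff_gradient df) -(deriveE _ dT) TE /gradient_form.
by apply: eq_bigr => k _; rewrite mxE.
Qed.

Lemma derive_local_max (R : realType) (V : normedModType R) (f : V -> R) (x v : V) :
  (\forall y \near x, derivable f y v /\ f y <= f x) -> 'D_v f x = 0.
Proof.
move=> fx.
have : \forall t \near (0 : R), derivable f (x + t *: v) v /\ f (x + t *: v) <= f x.
  have cvg0 : (fun t : R => x + t *: v) @ (0 : R) --> x.
    rewrite -[X in _ --> X]addr0 -[X in _ --> _ + X](scale0r v).
    by apply: cvgD; [|apply: cvgZ]; [exact: cvg_cst|exact: cvg_id|exact: cvg_cst].
  exact: cvg0 fx.
move=> /nbhs_ballP[d /= d0 dP].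
have inB (t : R) : t \in `]- d, d[%R -> ball (0 : R) d t.
  by rewrite in_itv /= -ball_normE /ball_/= sub0r normrN ltr_norml.
have d0' : (0 : R) \in `]- d, d[%R by rewrite in_itv /= oppr_lt0 d0.
have dphi t : t \in `]- d, d[%R ->
    is_derive t (1 : R) (fun s : R => f (x + s *: v)) ('D_v f (x + t *: v)).
  by move=> /inB/dP[dft _]; exact: is_derive_line.
have dm : - d <= d by rewrite ge0_cp// ltW.
have [||_ E] := @derive1_at_max R (fun s : R => f (x + s *: v)) (- d) d 0 dm _ d0'.
- by move=> t /dphi[].
- by move=> t /inB/dP[_]; rewrite scale0r addr0.
- by have [_] := dphi _ d0'; rewrite E scale0r addr0.
Qed.

Lemma derive_mulmx (R : realType) (V : normedModType R) (m n p : nat)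
    (A : V -> 'M[R]_(m, n)) (B : V -> 'M[R]_(n, p)) (x v : V) :
  derivable A x v -> derivable B x v ->
  derivable (fun y => A y *m B y) x v /\
  'D_v (fun y => A y *m B y) x = 'D_v A x *m B x + A x *m 'D_v B x.
Proof.
move=> dA dB; have dA' := (derivable_mxP _ _ _).1 dA; have dB' := (derivable_mxP _ _ _).1 dB.
have entryE i j : (fun y => (A y *m B y) i j) =
    \sum_k ((fun y => A y i k) * (fun y => B y k j)).
  by apply/funext => y; rewrite mxE fct_sumE.
have dAB : derivable (fun y => A y *m B y) x v.
  apply/derivable_mxP => i j; rewrite entryE.
  by apply: derivable_sum => k; exact: derivableM.
split => //; rewrite !derive_mx//; apply/matrixP => i j.
rewrite !mxE entryE derive_sum; last by move=> k; exact: derivableM.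
rewrite -big_split; apply: eq_bigr => k _ /=.
rewrite deriveM// !mxE /GRing.scale/= addrC; congr (_ + _).
by rewrite mulrC.
Qed.

Lemma derivable_prod (R : realType) (V : normedModType R) (I : Type) (r : seq I)
    (f : I -> V -> R) (x v : V) :
  (forall i, derivable (f i) x v) -> derivable (fun y => \prod_(i <- r) f i y) x v.
Proof.
move=> df; elim: r => [|i r IH].
  under eq_fun do rewrite big_nil; exact: derivable_cst.
by under eq_fun do rewrite big_cons; exact: derivableM (df i) IH.
Qed.

Lemma derivable_bigsum (R : realType) (V : normedModType R) (I : Type) (r : seq I)
    (f : I -> V -> R) (x v : V) :
  (forall i, derivable (f i) x v) -> derivable (fun y => \sum_(i <- r) f i y) x v.
Proof.
move=> df; elim: r => [|i r IH].
  under eq_fun do rewrite big_nil; exact: derivable_cst.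
by under eq_fun do rewrite big_cons; exact: derivableD (df i) IH.
Qed.

Lemma derivable_det (R : realType) (V : normedModType R) (n : nat)
    (A : V -> 'M[R]_n) (x v : V) :
  derivable A x v -> derivable (fun y => \det (A y)) x v.
Proof.
move=> /derivable_mxP dA.
apply: derivable_bigsum => s; apply: derivableM; first exact: derivable_cst.
by apply: derivable_prod => i.
Qed.

(** By Cramer's rule the inverse is a rational function of the entries. *)
Lemma derivable_invmx (R : realType) (V : normedModType R) (n : nat)
    (A : V -> 'M[R]_n) (x v : V) :
  derivable A x v -> (\forall y \near x, A y \in unitmx) ->
  derivable (fun y => invmx (A y)) x v.
Proof.
move=> dA uA; have Ax := nbhs_singleton uA.
apply: (@near_eq_derivable _ _ _ (fun y => (\det (A y))^-1 *: \adj (A y))).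
  by apply: filterS uA => y; rewrite /invmx => ->.
apply/derivable_mxP => i j; under eq_fun do rewrite !mxE.
apply: derivableM.
  by apply: derivableV; [rewrite -unitfE -unitmxE | exact: derivable_det].
apply: derivableM; first exact: derivable_cst.
apply: derivable_det; apply/derivable_mxP => k l; under eq_fun do rewrite !mxE.
exact: ((derivable_mxP _ _ _).1 dA).
Qed.

(** * The Levi-Civita connection in a chart *)

(** Positivity enters the local computations only through invertibility. *)
Definition metric_on (R : realType) (n : nat) (U : set 'rV[R]_n)
    (g : 'rV[R]_n -> 'M[R]_n) : Prop :=
  [/\ open U, forall i j, smooth_on U (fun y => g y i j),
      forall x, U x -> (g x)^T = g x & forall x, U x -> g x \in unitmx].

Definition smooth_field_on (R : realType) (n : nat) (U : set 'rV[R]_n)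
    (X : 'rV[R]_n -> 'rV[R]_n) : Prop :=
  forall i, smooth_on U (fun y => X y 0 i).

Definition partial_mx (R : realType) (n p q : nat) (k : 'I_n)
    (A : 'rV[R]_n -> 'M[R]_(p, q)) (x : 'rV[R]_n) : 'M[R]_(p, q) :=
  \matrix_(i, j) partial k (fun y => A y i j) x.

Definition derivable_along (R : realType) (n p q : nat) (k : 'I_n)
    (A : 'rV[R]_n -> 'M[R]_(p, q)) (x : 'rV[R]_n) : Prop :=
  derivable A x (basis_vec R k).

Lemma partial_mxE (R : realType) (n p q : nat) (k : 'I_n)
    (A : 'rV[R]_n -> 'M[R]_(p, q)) (x : 'rV[R]_n) :
  derivable_along k A x -> 'D_(basis_vec R k) A x = partial_mx k A x.
Proof. exact: derive_mx. Qed.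

Lemma near_eq_partial_mx (R : realType) (n p q : nat) (k : 'I_n)
    (A B : 'rV[R]_n -> 'M[R]_(p, q)) (x : 'rV[R]_n) :
  (\forall y \near x, A y = B y) -> partial_mx k A x = partial_mx k B x.
Proof.
move=> AB; apply/matrixP => i j; rewrite !mxE.
by apply: near_eq_derive; apply: filterS AB => y ->.
Qed.

Lemma partial_mulmx (R : realType) (n p q r : nat) (k : 'I_n)
    (A : 'rV[R]_n -> 'M[R]_(p, q)) (B : 'rV[R]_n -> 'M[R]_(q, r)) (x : 'rV[R]_n) :
  derivable_along k A x -> derivable_along k B x ->
  partial_mx k (fun y => A y *m B y) x =
  partial_mx k A x *m B x + A x *m partial_mx k B x.
Proof.
move=> dA dB; have [dAB E] := derive_mulmx dA dB.
by rewrite -!partial_mxE.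
Qed.

Lemma partial_trmx (R : realType) (n p q : nat) (k : 'I_n)
    (A : 'rV[R]_n -> 'M[R]_(p, q)) (x : 'rV[R]_n) :
  partial_mx k (fun y => (A y)^T) x = (partial_mx k A x)^T.
Proof.
apply/matrixP => i j; rewrite !mxE.
by have -> : (fun y => (A y)^T i j) = (fun y => A y j i) by apply/funext => y; rewrite mxE.
Qed.

Lemma partial_addmx (R : realType) (n p q : nat) (k : 'I_n)
    (A B : 'rV[R]_n -> 'M[R]_(p, q)) (x : 'rV[R]_n) :
  derivable_along k A x -> derivable_along k B x ->
  partial_mx k (fun y => A y + B y) x = partial_mx k A x + partial_mx k B x.
Proof.
move=> dA dB; have dAB : derivable_along k (fun y => A y + B y) x := derivableD dA dB.
by rewrite -(partial_mxE dA) -(partial_mxE dB) -(partial_mxE dAB) -(deriveD dA dB).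
Qed.

Lemma partialM (R : realType) (n : nat) (k : 'I_n) (f g : 'rV[R]_n -> R) (x : 'rV[R]_n) :
  derivable f x (basis_vec R k) -> derivable g x (basis_vec R k) ->
  partial k (fun y => f y * g y) x = partial k f x * g x + f x * partial k g x.
Proof.
move=> df dg; have := deriveM df dg; rewrite /partial => ->.
rewrite addrC; congr (_ + _).
by rewrite /GRing.scale/= mulrC.
Qed.

Lemma partial_scalemx (R : realType) (n p q : nat) (k : 'I_n)
    (a : 'rV[R]_n -> R) (A : 'rV[R]_n -> 'M[R]_(p, q)) (x : 'rV[R]_n) :
  derivable a x (basis_vec R k) -> derivable_along k A x ->
  partial_mx k (fun y => a y *: A y) x = partial k a x *: A x + a x *: partial_mx k A x.
Proof.
move=> da dA; apply/matrixP => i j; rewrite !mxE.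
under eq_fun do rewrite mxE.
exact: partialM da ((derivable_mxP _ _ _).1 dA i j).
Qed.

Lemma sum_mulrb_eq (R : pzRingType) (n : nat) (F : 'I_n -> R) (j : 'I_n) :
  \sum_m F m *+ (m == j) = F j.
Proof.
rewrite (bigD1 j) //= eqxx mulr1n big1 => [|m /negPf ->]; first exact: addr0.
exact: mulr0n.
Qed.

Section chart_calculus.
Context (R : realType) (n : nat) (U : set 'rV[R]_n) (g : 'rV[R]_n -> 'M[R]_n).
Hypothesis gU : metric_on U g.

Lemma metric_derivable k x : U x -> derivable_along k g x.
Proof.
case: gU => oU sg _ _ Ux; apply/derivable_mxP => i j.
exact: (smooth_on_derivable (sg i j)).
Qed.

Lemma metric_symmetric x i j : U x -> g x i j = g x j i.
Proof. by case: gU => _ _ sym _ /sym E; rewrite -[in RHS]E mxE. Qed.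

Lemma partial_metric_symmetric k i j x : U x ->
  partial k (fun y => g y i j) x = partial k (fun y => g y j i) x.
Proof.
case: (gU) => oU _ _ _ Ux; apply: near_eq_derive.
by apply: filterS (open_nbhs_nbhs (conj oU Ux)) => y /metric_symmetric.
Qed.

Lemma gup_derivable i j k x : U x -> derivable (gup g i j) x (basis_vec R k).
Proof.
case: (gU) => oU _ _ ug Ux.
have dg : derivable_along k (fun y => invmx (g y)) x.
  apply: derivable_invmx; first exact: metric_derivable.
  by apply: filterS (open_nbhs_nbhs (conj oU Ux)) => y; exact: ug.
exact: ((derivable_mxP _ _ _).1 dg).
Qed.

Lemma christoffel_derivable i j k l x : U x ->
  derivable (christoffel g i j k) x (basis_vec R l).
Proof.
case: (gU) => oU sg _ _ Ux; apply: derivableM; first exact: derivable_cst.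
apply: derivable_bigsum => m; apply: derivableM; first exact: gup_derivable.
have dd a b c : derivable (partial a (fun y => g y b c)) x (basis_vec R l).
  exact: (smooth_on_derivable (smooth_on_partial (sg b c) a)).
by apply: derivableB => //; exact: derivableD.
Qed.

Lemma christoffel_symmetric i j k x : U x -> christoffel g i j k x = christoffel g i k j x.
Proof.
move=> Ux; rewrite /christoffel; congr (_ * _); apply: eq_bigr => l _.
rewrite (partial_metric_symmetric l j k Ux); congr (_ * _).
by rewrite [X in X - _]addrC.
Qed.

(** The Christoffel symbols of the first kind. *)
Lemma lower_christoffel k i j x : U x ->
  \sum_l christoffel g l k i x * g x l j =
  2^-1 * (partial k (fun y => g y i j) x + partial i (fun y => g y k j) x
          - partial j (fun y => g y k i) x).
Proof.
case: (gU) => oU _ sg ug Ux.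
transitivity (2^-1 * \sum_m (\sum_l gup g m l x * g x l j) *
  (partial k (fun y => g y i m) x + partial i (fun y => g y k m) x
     - partial m (fun y => g y k i) x)).
  rewrite mulr_sumr; under eq_bigr do rewrite /christoffel -mulrA mulr_suml mulr_sumr.
  rewrite exchange_big /=; apply: eq_bigr => m _.
  rewrite mulr_suml mulr_sumr; apply: eq_bigr => l _.
  have -> : gup g l m x = gup g m l x.
    have symV : (invmx (g x))^T = invmx (g x) by rewrite trmx_inv sg.
    by rewrite /gup -[in RHS]symV mxE.
  by congr (_ * _); rewrite mulrAC.
have gV m : \sum_l gup g m l x * g x l j = (m == j)%:R.
  by have /matrixP/(_ m j) := mulVmx (ug x Ux); rewrite !mxE.
congr (_ * _); under eq_bigr do rewrite gV mulr_natl.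
exact: sum_mulrb_eq.
Qed.

(** The connection as one matrix per direction. It acts on row vectors from the
    right, so that the covariant derivative of [X] in direction [j] is
    [partial_mx j X + X *m connection_mx j]; tensor identities then become
    matrix identities. *)
Definition connection_mx (j : 'I_n) (x : 'rV[R]_n) : 'M[R]_n :=
  \matrix_(k, i) christoffel g i j k x.

Lemma connection_metric k i j x : U x -> (connection_mx k x *m g x) i j =
  2^-1 * (partial k (fun y => g y i j) x + partial i (fun y => g y k j) x
          - partial j (fun y => g y k i) x).
Proof.
move=> Ux; rewrite -lower_christoffel// mxE.
by apply: eq_bigr => l _; rewrite mxE.
Qed.

Lemma metric_compatibility k x : U x ->
  partial_mx k g x = connection_mx k x *m g x + (connection_mx k x *m g x)^T.
Proof.
move=> Ux; apply/matrixP => i j; rewrite [in RHS]mxE [X in _ = _ + X]mxE !connection_metric// mxE.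
rewrite (partial_metric_symmetric k j i)//.
have half (a b c : R) : a = 2^-1 * (a + b - c) + 2^-1 * (a + c - b) by field.
exact: half.
Qed.

Variable X : 'rV[R]_n -> 'rV[R]_n.
Hypothesis sX : smooth_field_on U X.

Definition nabla_mx (x : 'rV[R]_n) : 'M[R]_n := \matrix_(k, i) nabla g X k i x.

Definition nabla2_mx (j : 'I_n) (x : 'rV[R]_n) : 'M[R]_n :=
  \matrix_(k, i) nabla2 g X j k i x.

Lemma nabla_derivable j x : U x -> derivable_along j nabla_mx x.
Proof.
move=> Ux; apply/derivable_mxP => k i; under eq_fun do rewrite mxE.
apply: derivableD.
  exact: (smooth_on_derivable (smooth_on_partial (sX i) k)).
apply: derivable_bigsum => l; apply: derivableM; first exact: christoffel_derivable.
exact: (smooth_on_derivable (sX l)).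
Qed.

Lemma nabla2_mxE j x : nabla2_mx j x =
  partial_mx j nabla_mx x + nabla_mx x *m connection_mx j x - connection_mx j x *m nabla_mx x.
Proof.
apply/matrixP => k i; rewrite !mxE /nabla2.
have -> : (fun y => nabla_mx y k i) = nabla g X k i by apply/funext => y; rewrite mxE.
congr (_ + _ - _); apply: eq_bigr => l _; rewrite !mxE//; exact: mulrC.
Qed.

(** The Lie derivative of the metric is the symmetrized covariant derivative:
    after lowering an index, the Christoffel terms of the two summands add up to
    the derivative of [g] along [X]. *)
Lemma lie_metric_nabla x i j : U x ->
  lie_metric g X i j x = (nabla_mx x *m g x + (nabla_mx x *m g x)^T) i j.
Proof.
move=> Ux.
have NG a b : (nabla_mx x *m g x) a b =
    \sum_k g x k b * partial a (fun y => X y 0 k) x +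
    \sum_l X x 0 l * (2^-1 * (partial a (fun y => g y l b) x + partial l (fun y => g y a b) x
          - partial b (fun y => g y a l) x)).
  rewrite mxE; under eq_bigr do rewrite mxE /nabla mulrDl.
  rewrite big_split /=; congr (_ + _); first by apply: eq_bigr => k _; rewrite mulrC.
  under eq_bigr do rewrite mulr_suml.
  rewrite exchange_big /=; apply: eq_bigr => l _.
  rewrite -lower_christoffel// mulr_sumr; apply: eq_bigr => k _.
  by rewrite mulrAC mulrC.
rewrite mxE [X in _ = _ + X]mxE !NG addrACA.
rewrite /lie_metric !big_split /= -addrA addrC.
congr (_ + _ + _); first by apply: eq_bigr => k _; rewrite metric_symmetric.
rewrite -big_split /=.
apply: eq_bigr => l _; rewrite -mulrDr; congr (_ * _).
rewrite (partial_metric_symmetric l j i)// (partial_metric_symmetric j i l)//.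
rewrite (partial_metric_symmetric i j l)//.
have half (a b c : R) : a = 2^-1 * (b + a - c) + 2^-1 * (c + a - b) by field.
exact: half.
Qed.

End chart_calculus.

(** * Conformal fields satisfy box X = (n - 2) grad rho *)

Section conformal_fields.
Context (R : realType) (n : nat) (U : set 'rV[R]_n) (g : 'rV[R]_n -> 'M[R]_n).
Hypothesis gU : metric_on U g.
Variable X : 'rV[R]_n -> 'rV[R]_n.
Hypothesis sX : smooth_field_on U X.

Lemma partial_nabla j k i x : U x ->
  partial j (nabla g X k i) x =
  partial j (partial k (fun y => X y 0 i)) x
  + \sum_l (partial j (christoffel g i k l) x * X x 0 l
            + christoffel g i k l x * partial j (fun y => X y 0 l) x).
Proof.
move=> Ux.
have dX l : derivable (fun y => X y 0 l) x (basis_vec R j).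
  exact: (smooth_on_derivable (sX l)).
have dG l : derivable (christoffel g i k l) x (basis_vec R j).
  exact: (christoffel_derivable gU).
have dP : derivable (partial k (fun y => X y 0 i)) x (basis_vec R j).
  exact: (smooth_on_derivable (smooth_on_partial (sX i) k)).
have dGX l : derivable (fun y => christoffel g i k l y * X y 0 l) x (basis_vec R j).
  exact: derivableM (dG l) (dX l).
pose F := \sum_l (fun y => christoffel g i k l y * X y 0 l).
have FE : F = (fun y => \sum_l christoffel g i k l y * X y 0 l).
  by apply/funext => y; rewrite /F fct_sumE.
have dF : derivable F x (basis_vec R j) by exact: derivable_sum dGX.
have -> : nabla g X k i = partial k (fun y => X y 0 i) + F by rewrite FE.
rewrite /partial (deriveD dP dF) (derive_sum dGX); congr (_ + _).
by apply: eq_bigr => l _; exact: (partialM (dG l) (dX l)).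
Qed.

(** [nabla2] splits into a part that is symmetric in the two directions of
    differentiation and a part whose antisymmetrization is the curvature. *)
Definition nabla2_sym (j k i : 'I_n) (x : 'rV[R]_n) : R :=
  partial j (partial k (fun y => X y 0 i)) x
  + \sum_l (christoffel g i k l x * partial j (fun y => X y 0 l) x
            + christoffel g i j l x * partial k (fun y => X y 0 l) x)
  - \sum_l christoffel g l j k x * nabla g X l i x.

Definition nabla2_curv (j k i : 'I_n) (x : 'rV[R]_n) : R :=
  \sum_l (partial j (christoffel g i k l) x
          + \sum_m christoffel g i j m x * christoffel g m k l x) * X x 0 l.

Lemma nabla2_split j k i x : U x ->
  nabla2 g X j k i x = nabla2_sym j k i x + nabla2_curv j k i x.
Proof.
move=> Ux; rewrite /nabla2 partial_nabla// /nabla2_sym /nabla2_curv.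
have -> : \sum_l christoffel g i j l x * nabla g X k l x =
    \sum_l christoffel g i j l x * partial k (fun y => X y 0 l) x +
    \sum_l (\sum_m christoffel g i j m x * christoffel g m k l x) * X x 0 l.
  under eq_bigr do rewrite /nabla mulrDr; rewrite big_split; congr (_ + _).
  under eq_bigr do rewrite mulr_sumr; rewrite exchange_big; apply: eq_bigr => l _.
  by rewrite mulr_suml; apply: eq_bigr => m _; rewrite mulrA.
under [X in _ = _ + X]eq_bigr do rewrite mulrDl.
rewrite !big_split /=.
have comb (a b c d e f : R) : a + (b + c) + (d + e) - f = a + (c + d) - f + (b + e) by ring.
exact: comb.
Qed.

Lemma nabla2_symC j k i x : U x -> nabla2_sym j k i x = nabla2_sym k j i x.
Proof.
case: (gU) => oU _ _ _ Ux; rewrite /nabla2_sym (Schwarz j k oU (sX i) Ux).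
under eq_bigr do rewrite addrC.
by under [X in _ - X]eq_bigr do rewrite (christoffel_symmetric gU _ _ _ Ux).
Qed.

Lemma contracted_curvature b x :
  \sum_j (nabla2_curv j b j x - nabla2_curv b j j x) = \sum_l ricci g b l x * X x 0 l.
Proof.
rewrite /nabla2_curv; under eq_bigr do rewrite -sumrB.
rewrite exchange_big; apply: eq_bigr => l _ /=.
under eq_bigr do rewrite -mulrBl opprD addrACA -sumrB.
by rewrite -mulr_suml big_split.
Qed.

(** Commuting the two covariant derivatives leaves the curvature, whose trace is
    the Ricci tensor. *)
Lemma contracted_Ricci_identity b x : U x ->
  \sum_j nabla2 g X j b j x =
  \sum_j nabla2 g X b j j x + \sum_l ricci g b l x * X x 0 l.
Proof.
move=> Ux; rewrite -contracted_curvature -big_split /=; apply: eq_bigr => j _.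
rewrite !nabla2_split// nabla2_symC//.
have comb (s q r : R) : s + q = s + r + (q - r) by ring.
exact: comb.
Qed.

Lemma partial_trace (A : 'rV[R]_n -> 'M[R]_n) k x :
  derivable_along k A x ->
  partial k (fun y => \tr (A y)) x = \tr (partial_mx k A x) /\
  derivable (fun y => \tr (A y)) x (basis_vec R k).
Proof.
move=> dA; have dAii i := (derivable_mxP _ _ _).1 dA i i.
have -> : (fun y => \tr (A y)) = \sum_i (fun y => A y i i).
  by apply/funext => y; rewrite fct_sumE.
split; last exact: derivable_sum dAii.
by rewrite /partial (derive_sum dAii); apply: eq_bigr => i _; rewrite mxE.
Qed.

(** The connection terms of [nabla2_mxE] form a commutator, which is
    trace-free. *)
Lemma trace_nabla2 b x : U x ->
  \sum_j nabla2 g X b j j x = partial b (fun y => \tr (nabla_mx g X y)) x.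
Proof.
move=> Ux; have [-> _] := partial_trace (nabla_derivable gU sX (j := b) Ux).
transitivity (\tr (nabla2_mx g X b x)); first by apply: eq_bigr => j _; rewrite mxE.
by rewrite nabla2_mxE linearB linearD /= mxtrace_mulC addrK.
Qed.

Variable rho : 'rV[R]_n -> R.
Hypothesis confX : forall x, U x -> forall i j,
  lie_metric g X i j x = 2 * rho x * g x i j.

Lemma conformal_nabla x : U x ->
  nabla_mx g X x *m g x + (nabla_mx g X x *m g x)^T = (2 * rho x) *: g x.
Proof.
move=> Ux; apply/matrixP => i j; rewrite -(lie_metric_nabla gU)// confX//.
by rewrite mxE.
Qed.

Lemma conformal_trace x : U x -> \tr (nabla_mx g X x) = n%:R * rho x.
Proof.
case: (gU) => _ _ sg ug Ux.
have := congr1 (fun A => \tr (A *m invmx (g x))) (conformal_nabla Ux).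
rewrite mulmxDl linearD /= mulmxK ?ug// trmx_mul sg// mxtrace_mulC mulKmx ?ug//.
rewrite mxtrace_tr -scalemxAl mulmxV ?ug// linearZ /= mxtrace1 => E.
by have : 2 * \tr (nabla_mx g X x) = 2 * (n%:R * rho x); lra.
Qed.

Hypothesis n_gt0 : (0 < n)%N.

Lemma conformal_factor_trace x : U x -> rho x = n%:R^-1 * \tr (nabla_mx g X x).
Proof. by move=> Ux; rewrite conformal_trace// mulKf// pnatr_eq0 -lt0n. Qed.

(** The trace of the equation expresses [rho] through first derivatives of [X],
    so that its regularity follows from that of [X]. *)
Lemma conformal_factor_derivable k x : U x -> derivable rho x (basis_vec R k).
Proof.
case: (gU) => oU _ _ _ Ux.
apply: (@near_eq_derivable _ _ _ (fun y => n%:R^-1 * \tr (nabla_mx g X y))).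
  apply: filterS (open_nbhs_nbhs (conj oU Ux)) => y Uy.
  by rewrite conformal_factor_trace.
apply: derivableM; first exact: derivable_cst.
by have [] := partial_trace (nabla_derivable gU sX (j := k) Ux).
Qed.

Lemma partial_divergence k x : U x ->
  partial k (fun y => \tr (nabla_mx g X y)) x = n%:R * partial k rho x.
Proof.
case: (gU) => oU _ _ _ Ux.
transitivity (partial k (fun y => n%:R * rho y) x).
  apply: near_eq_derive; apply: filterS (open_nbhs_nbhs (conj oU Ux)) => y Uy.
  by rewrite conformal_trace.
rewrite (partialM (derivable_cst _ _ _) (conformal_factor_derivable (k := k) Ux)).
by rewrite /partial derive_cst mul0r add0r.
Qed.

(** The covariant derivative of the conformal Killing equation; since the metric
    is parallel, only [rho] gets differentiated on the right-hand side. *)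
Lemma conformal_nabla2 j x : U x ->
  nabla2_mx g X j x *m g x + (nabla2_mx g X j x *m g x)^T = (2 * partial j rho x) *: g x.
Proof.
case: (gU) => oU _ sg ug Ux.
have dN := nabla_derivable gU sX (j := j) Ux; have dg := metric_derivable gU (k := j) Ux.
have [dNg _] := derive_mulmx dN dg.
have dNgT : derivable_along j (fun y => (nabla_mx g X y *m g y)^T) x.
  apply/derivable_mxP => a b; under eq_fun do rewrite mxE.
  exact: ((derivable_mxP _ _ _).1 dNg).
have d2rho : derivable (fun y => 2 * rho y) x (basis_vec R j).
  apply: derivableM; first exact: derivable_cst.
  exact: conformal_factor_derivable.
have := @near_eq_partial_mx R n n n j (fun y => nabla_mx g X y *m g y + (nabla_mx g X y *m g y)^T)
  (fun y => (2 * rho y) *: g y) x.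
have near_conf : \forall y \near x,
    nabla_mx g X y *m g y + (nabla_mx g X y *m g y)^T = (2 * rho y) *: g y.
  by apply: filterS (open_nbhs_nbhs (conj oU Ux)) => y; exact: conformal_nabla.
move=> /(_ near_conf).
rewrite (partial_addmx dNg dNgT) partial_trmx (partial_scalemx d2rho dg).
rewrite (partialM (derivable_cst _ _ _) (conformal_factor_derivable (k := j) Ux)).
rewrite [X in (X * _ + _) *: _]derive_cst mul0r add0r.
have PN : partial_mx j (nabla_mx g X) x = nabla2_mx g X j x
    - nabla_mx g X x *m connection_mx g j x + connection_mx g j x *m nabla_mx g X x.
  have comb (p a b : 'M[R]_n) : p = p + a - b - a + b.
    by rewrite [p + a - b - a]addrAC addrK subrK.
  by rewrite nabla2_mxE; exact: comb.
set C := connection_mx g j x in PN *; set N := nabla_mx g X x in PN *.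
have DNg : partial_mx j (fun y => nabla_mx g X y *m g y) x =
    nabla2_mx g X j x *m g x + (C *m (N *m g x) + (N *m g x) *m C^T).
  rewrite (partial_mulmx dN dg) -/N PN (metric_compatibility gU)// -/C.
  rewrite trmx_mul sg// mulmxDl mulmxBl mulmxDr !mulmxA.
  have comb (a b c d : 'M[R]_n) : a - b + c + (b + d) = a + (c + d).
    by rewrite -!addrA [- b + _]addrCA addKr.
  exact: comb.
rewrite DNg linearD /= addrACA.
have -> : C *m (N *m g x) + N *m g x *m C^T + (C *m (N *m g x) + N *m g x *m C^T)^T
  = C *m (N *m g x + (N *m g x)^T) + (N *m g x + (N *m g x)^T) *m C^T.
  rewrite linearD /= trmx_mul [(_ *m C^T)^T]trmx_mul trmxK mulmxDr mulmxDl.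
  have comb (a b c d : 'M[R]_n) : a + b + (c + d) = a + d + (b + c).
    by rewrite [c + d]addrC addrACA.
  exact: comb.
rewrite conformal_nabla// -scalemxAr -scalemxAl -scalerDr.
rewrite (metric_compatibility gU)// -/C [(C *m g x)^T]trmx_mul sg//.
exact: addIr.
Qed.

(** Raise an index of [conformal_nabla2] and contract it with the direction of
    differentiation. The first summand becomes the connection Laplacian of [X];
    the second is, by the Ricci identity, the Ricci term plus the derivative of
    the divergence [n rho]. The right-hand side is twice the differential of
    [rho], and [2 - n] of it remain. *)
Lemma box_conformal i x : U x ->
  box g X i x = (n%:R - 2) * \sum_b partial b rho x * gup g b i x.
Proof.
case: (gU) => oU _ sg ug Ux.
have symV : (invmx (g x))^T = invmx (g x) by rewrite trmx_inv sg.
have gupC a b : gup g a b x = gup g b a x by rewrite /gup -[in RHS]symV mxE.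
(* [L] is the connection Laplacian of [X], [RX] the Ricci tensor applied to
   [X] with the index down, [dr] the differential of [rho]. *)
pose L : 'rV[R]_n := \row_k \sum_j \sum_a gup g j a x * nabla2 g X j a k x.
pose dr : 'rV[R]_n := \row_b partial b rho x.
pose RX : 'rV[R]_n := \row_b \sum_l ricci g b l x * X x 0 l.
have LE : L *m g x + RX = (2 - n%:R) *: dr.
  have E j : invmx (g x) *m nabla2_mx g X j x *m g x + (nabla2_mx g X j x)^T
      = (2 * partial j rho x)%:M.
    have := congr1 (mulmx (invmx (g x))) (conformal_nabla2 j Ux).
    rewrite mulmxDr trmx_mul sg// mulKmx ?ug// mulmxA => ->.
    by rewrite -scalemxAr mulVmx ?ug// scalemx1.
  apply/rowP => b.
  have : \sum_j (invmx (g x) *m nabla2_mx g X j x *m g x + (nabla2_mx g X j x)^T) j b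
      = 2 * partial b rho x.
    under eq_bigr do rewrite E mxE.
    exact: (sum_mulrb_eq (fun j => 2 * partial j rho x)).
  under eq_bigr do rewrite mxE [X in _ + X]mxE [X in _ + X]mxE.
  rewrite big_split /= contracted_Ricci_identity// trace_nabla2// partial_divergence//.
  have -> : \sum_j (invmx (g x) *m nabla2_mx g X j x *m g x) j b = (L *m g x) 0 b.
    rewrite mxE; under eq_bigr do rewrite mxE.
    rewrite exchange_big; apply: eq_bigr => k _ /=.
    rewrite -mulr_suml; congr (_ * _); rewrite mxE; apply: eq_bigr => j _.
    by rewrite mxE; apply: eq_bigr => a _; rewrite mxE.
  rewrite !mxE mulrBl; set s := \sum_l _; move=> <-.
  have comb (l a r : R) : l + r = l + (a + r) - a by ring.
  exact: comb.
have -> : box g X i x = ((n%:R - 2) *: dr *m invmx (g x)) 0 i.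
  rewrite -opprB -[_ *: dr]opprK -scaleNr opprK.
  have -> : - ((2 - n%:R) *: dr) = - (L *m g x + RX) by rewrite LE.
  rewrite mulNmx mulmxDl mulmxK ?ug// /box mxE; congr (- _).
  rewrite mxE mxE; congr (_ + _).
    under eq_bigr do rewrite /ricci_up mulr_suml.
    rewrite exchange_big mxE; apply: eq_bigr => k _ /=; rewrite mxE mulr_suml.
    by apply: eq_bigr => l _; rewrite gupC -mulrA mulrC.
rewrite -scalemxAl mxE; congr (_ * _).
by rewrite mxE; apply: eq_bigr => b _; rewrite mxE.
Qed.

End conformal_fields.

(** * The squared length of a conformal field *)

Definition norm2 (R : realType) (n : nat) (g : 'rV[R]_n -> 'M[R]_n)
    (X : 'rV[R]_n -> 'rV[R]_n) (x : 'rV[R]_n) : R :=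
  (X x *m g x *m (X x)^T) 0 0.

Lemma norm2E (R : realType) (n : nat) (g : 'rV[R]_n -> 'M[R]_n)
    (X : 'rV[R]_n -> 'rV[R]_n) (x : 'rV[R]_n) :
  norm2 g X x = \sum_i \sum_j g x i j * X x 0 i * X x 0 j.
Proof.
rewrite /norm2 mxE; under eq_bigr do rewrite mxE mxE mulr_suml.
rewrite exchange_big; apply: eq_bigr => i _; apply: eq_bigr => j _ /=.
by rewrite [X x 0 i * _]mulrC.
Qed.

Definition derive_field (R : realType) (n : nat)
    (X : 'rV[R]_n -> 'rV[R]_n) (f : 'rV[R]_n -> R) (x : 'rV[R]_n) : R :=
  \sum_k X x 0 k * partial k f x.

Section norm2_calculus.
Context (R : realType) (n : nat) (U : set 'rV[R]_n) (g : 'rV[R]_n -> 'M[R]_n).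
Hypothesis gU : metric_on U g.
Variable X : 'rV[R]_n -> 'rV[R]_n.
Hypothesis sX : smooth_field_on U X.

Lemma norm2_differentiable x : U x -> differentiable (norm2 g X) x.
Proof.
case: (gU) => oU sg _ _ Ux.
have -> : norm2 g X = \sum_i \sum_j
    ((fun y => g y i j) * (fun y => X y 0 i) * (fun y => X y 0 j)).
  apply/funext => y; rewrite norm2E fct_sumE; apply: eq_bigr => i _.
  by rewrite fct_sumE.
have dg i j := smooth_on_differentiable oU (sg i j) Ux.
have dX i := smooth_on_differentiable oU (sX i) Ux.
apply: differentiable_sum => i; apply: differentiable_sum => j.
exact: differentiableM (differentiableM (dg i j) (dX i)) (dX j).
Qed.

Definition jacobian_mx (x : 'rV[R]_n) : 'M[R]_n :=
  \matrix_(i, k) partial i (fun y => X y 0 k) x.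

Lemma lie_metric_mx x : U x ->
  \matrix_(i, j) lie_metric g X i j x =
  \sum_k X x 0 k *: partial_mx k g x + jacobian_mx x *m g x + (jacobian_mx x *m g x)^T.
Proof.
move=> Ux; apply/matrixP => i j; rewrite mxE /lie_metric !big_split /=.
rewrite [RHS]mxE [X in _ = X + _]mxE summxE; congr (_ + _ + _).
- by apply: eq_bigr => k _; rewrite !mxE.
- by rewrite mxE; apply: eq_bigr => k _; rewrite mxE mulrC.
- rewrite !mxE; apply: eq_bigr => k _; rewrite mxE mulrC.
  by rewrite (metric_symmetric gU).
Qed.

(** The derivative of [g(X, X)] along [X] equals [(L_X g)(X, X)], because the
    bracket of [X] with itself vanishes. *)
Lemma derive_norm2 x : U x ->
  derive_field X (norm2 g X) x = (X x *m (\matrix_(i, j) lie_metric g X i j x) *m (X x)^T) 0 0.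
Proof.
move=> Ux; rewrite lie_metric_mx//; case: (gU) => _ _ sg _.
have dX k : derivable_along k X x.
  apply/derivable_mxP => i j; rewrite ord1.
  exact: (smooth_on_derivable (sX j)).
have dXT k : derivable_along k (fun y => (X y)^T) x.
  apply/derivable_mxP => i j; under eq_fun do rewrite mxE.
  exact: ((derivable_mxP _ _ _).1 (dX k)).
have dg k := metric_derivable gU (k := k) Ux.
have dXg k := (derive_mulmx (dX k) (dg k)).1.
have step k : X x 0 k * partial k (norm2 g X) x =
    ((X x 0 k *: partial_mx k X x) *m g x *m (X x)^T +
     X x *m (X x 0 k *: partial_mx k g x) *m (X x)^T +
     X x *m g x *m (X x 0 k *: partial_mx k X x)^T) 0 0.
  have -> : partial k (norm2 g X) x = partial_mx k (fun y => X y *m g y *m (X y)^T) x 0 0.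
    by rewrite mxE.
  rewrite (partial_mulmx (dXg k) (dXT k)) (partial_mulmx (dX k) (dg k)) partial_trmx.
  have scale_entry (a : R) (A : 'M[R]_1) : a * A 0 0 = (a *: A) 0 0 by rewrite mxE.
  rewrite scale_entry mulmxDl !scalerDr; congr ((_ + _ + _ : 'M[R]_1) 0 0).
  - by rewrite -!scalemxAl.
  - by rewrite -scalemxAr -scalemxAl.
  - by rewrite [in RHS]linearZ /= -scalemxAr.
have XJ : \sum_k X x 0 k *: partial_mx k X x = X x *m jacobian_mx x.
  apply/rowP => i; rewrite summxE mxE; apply: eq_bigr => k _.
  by rewrite !mxE.
rewrite /derive_field; under eq_bigr do rewrite step.
rewrite -summxE !big_split /= -!mulmx_suml -!mulmx_sumr.
rewrite -[\sum_k (_ *: partial_mx k X x)^T]linear_sum /= XJ.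
rewrite !mulmxDr !mulmxDl !trmx_mul sg// !mulmxA.
by congr ((_ : 'M[R]_1) 0 0); rewrite [X in X + _]addrC.
Qed.

Lemma conformal_derive_norm2 (rho : 'rV[R]_n -> R) x :
  U x -> (forall i j, lie_metric g X i j x = 2 * rho x * g x i j) ->
  derive_field X (norm2 g X) x = 2 * rho x * norm2 g X x.
Proof.
move=> Ux conf; rewrite derive_norm2//.
have -> : \matrix_(i, j) lie_metric g X i j x = (2 * rho x) *: g x.
  by apply/matrixP => i j; rewrite !mxE conf.
by rewrite -scalemxAr -scalemxAl mxE.
Qed.

Lemma lie_metric0 i j x : (\forall y \near x, X y = 0) -> lie_metric g X i j x = 0.
Proof.
move=> X0; have Xx := nbhs_singleton X0; rewrite /lie_metric big1// => k _.
have p0 l m : partial l (fun y => X y 0 m) x = 0.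
  transitivity (partial l (cst 0) x); last exact: derive_cst.
  by apply: near_eq_derive; apply: filterS X0 => y ->; rewrite mxE.
by rewrite !p0 Xx mxE mul0r !mulr0 !addr0.
Qed.

End norm2_calculus.

(** * Vanishing of a locally constant conformal factor on a compact manifold *)

Lemma posdef_unitmx (R : realType) (n : nat) (A : 'M[R]_n) :
  (forall v : 'rV[R]_n, v != 0 -> 0 < \sum_i \sum_j A i j * v 0 i * v 0 j) ->
  A \in unitmx.
Proof.
move=> posA; rewrite -row_free_unit; apply/inj_row_free => v vA.
apply/eqP; apply: contraT => /posA; rewrite exchange_big big1 ?ltxx// => j _ /=.
have /rowP/(_ j) := vA; rewrite !mxE => vAj.
by rewrite -mulr_suml; under eq_bigr do rewrite mulrC; rewrite vAj mul0r.
Qed.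

Section soliton_charts.
Context (R : realType) (n : nat) (M : manifold R n) (g : riemannian_metric M)
  (V : vector_field M).
Local Notation chart_of := (atlas M).
Local Notation coord := Defs.coord.

Lemma chart_metric_on a : metric_on (img (chart_of a)) (g a).
Proof.
split; first exact: img_open.
- by move=> i j; exact: met_smooth.
- by move=> x ax; apply/matrixP => i j; rewrite mxE; exact: met_sym.
- by move=> x ax; apply: posdef_unitmx => v; exact: met_posdef.
Qed.

Lemma chart_field_on a : smooth_field_on (img (chart_of a)) (V a).
Proof. by move=> i; exact: vf_smooth. Qed.

Lemma coord_img (a : chart_index M) (p : M) :
  dom (chart_of a) p -> img (chart_of a) (coord (chart_of a) p).
Proof. by move=> ap; exists p. Qed.

Lemma norm2_ge0 a x : img (chart_of a) x -> 0 <= norm2 (g a) (V a) x.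
Proof.
move=> ax; rewrite norm2E; have [V0|] := eqVneq (V a x) 0.
  by rewrite big1// => i _; rewrite big1// => j _; rewrite V0 !mxE mulr0.
by move=> /(met_posdef g ax)/ltW.
Qed.

Lemma norm2_eq0 a x : img (chart_of a) x -> norm2 (g a) (V a) x = 0 -> V a x = 0.
Proof.
move=> ax N0; apply/eqP; apply: contraT => /(met_posdef g ax).
by rewrite -(norm2E (g a) (V a)) N0 ltxx.
Qed.

Lemma near_manifold a (p : M) (P : 'rV[R]_n -> Prop) : dom (chart_of a) p ->
  (\forall y \near coord (chart_of a) p, P y) ->
  \forall q \near p, dom (chart_of a) q /\ P (coord (chart_of a) q).
Proof.
move=> ap xP; apply: filterI; last exact: coord_cont xP.
by apply: open_nbhs_nbhs; split => //; exact: dom_open.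
Qed.

(** Stated with a point of the manifold rather than with [param], so that the
    conclusion can be fed to lemmas about [coord]. *)
Lemma near_chart a (p : M) (P : M -> Prop) : dom (chart_of a) p ->
  (\forall q \near p, P q) ->
  \forall y \near coord (chart_of a) p,
    exists q, [/\ dom (chart_of a) q, coord (chart_of a) q = y & P q].
Proof.
move=> ap pP; have xa := coord_img ap.
have := param_cont xa; rewrite /prop_for /continuous_at coordK// => /(_ _ pP) paramP.
have imga := open_nbhs_nbhs (conj (@img_open _ _ _ (chart_of a)) xa).
apply: filterS2 imga paramP => y [q aq <-]; rewrite /= coordK// => Pq.
by exists q.
Qed.

Lemma overlap_coord a b (p : M) : dom (chart_of a) p -> dom (chart_of b) p ->
  overlap (chart_of a) (chart_of b) (coord (chart_of a) p).
Proof. by move=> ap bp; exists p. Qed.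

Lemma transition_coord a b (p : M) : dom (chart_of a) p ->
  transition (chart_of a) (chart_of b) (coord (chart_of a) p) = coord (chart_of b) p.
Proof. by move=> ap; rewrite /transition coordK. Qed.

Lemma near_overlap a b (p : M) : dom (chart_of a) p -> dom (chart_of b) p ->
  \forall y \near coord (chart_of a) p, overlap (chart_of a) (chart_of b) y.
Proof.
move=> ap bp; have bnear : \forall q \near p, dom (chart_of b) q.
  by apply: open_nbhs_nbhs; split => //; exact: dom_open.
by apply: filterS (near_chart ap bnear) => y [q [aq <- bq]]; exact: overlap_coord.
Qed.

Lemma overlap_open a b : open (overlap (chart_of a) (chart_of b)).
Proof.
rewrite openE => _ [p [ap bp] <-]; exact: near_overlap.
Qed.

Lemma field_change a b x : overlap (chart_of a) (chart_of b) x ->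
  V b (transition (chart_of a) (chart_of b) x) = V a x *m change_mx a b x.
Proof.
by move=> ox; apply/rowP => k; rewrite (vf_change V ox) mxE; apply: eq_bigr => i _; exact: mulrC.
Qed.

Lemma metric_change a b x : overlap (chart_of a) (chart_of b) x ->
  g a x = change_mx a b x *m g b (transition (chart_of a) (chart_of b) x) *m (change_mx a b x)^T.
Proof.
move=> ox; apply/matrixP => i j; rewrite (met_change g ox) mxE.
under [RHS]eq_bigr do rewrite mxE mulr_suml.
rewrite exchange_big; apply: eq_bigr => k _; apply: eq_bigr => l _ /=.
by rewrite [_^T _ _]mxE mulrAC.
Qed.

Lemma norm2_change a b x : overlap (chart_of a) (chart_of b) x ->
  norm2 (g a) (V a) x = norm2 (g b) (V b) (transition (chart_of a) (chart_of b) x).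
Proof.
by move=> ox; rewrite /norm2 (field_change ox) (metric_change ox) trmx_mul !mulmxA.
Qed.

(** Both sides are the derivative of one function along one vector field: the
    chain rule for the transition map is the transpose of the transformation law
    of [V]. *)
Lemma derive_norm2_change a b (p : M) : dom (chart_of a) p -> dom (chart_of b) p ->
  derive_field (V a) (norm2 (g a) (V a)) (coord (chart_of a) p) =
  derive_field (V b) (norm2 (g b) (V b)) (coord (chart_of b) p).
Proof.
move=> ap bp; set x := coord (chart_of a) p.
pose T := transition (chart_of a) (chart_of b).
have ox : overlap (chart_of a) (chart_of b) x by exact: overlap_coord.
have Tx : T x = coord (chart_of b) p by exact: transition_coord.
have dT k := smooth_on_differentiable (@overlap_open a b) (atlas_smooth a b k) ox.
have dN : differentiable (norm2 (g b) (V b)) (T x).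
  rewrite Tx; apply: (norm2_differentiable (chart_metric_on b) (chart_field_on b)).
  exact: coord_img.
have pE i : partial i (norm2 (g a) (V a)) x =
    \sum_k change_mx a b x i k * partial k (norm2 (g b) (V b)) (T x).
  transitivity (partial i (fun y => norm2 (g b) (V b) (T y)) x).
    apply: near_eq_derive; apply: filterS (near_overlap ap bp) => y.
    exact: norm2_change.
  rewrite (partial_comp dT dN); apply: eq_bigr => k _.
  by rewrite mxE.
rewrite /derive_field -Tx; under eq_bigr do rewrite pE mulr_sumr.
rewrite exchange_big; apply: eq_bigr => k _ /=.
rewrite field_change// mxE mulr_suml; apply: eq_bigr => i _.
exact: mulrA.
Qed.

(** The factors form a family indexed by charts, as the scalar curvature is
    given by a formula in each chart; they agree on overlaps by
    [factor_change]. *)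
Variable rho : chart_index M -> 'rV[R]_n -> R.
Hypothesis conformal : forall a x, img (chart_of a) x -> forall i j,
  lie_metric (g a) (V a) i j x = 2 * rho a x * g a x i j.
Hypothesis n_gt0 : (0 < n)%N.

Lemma derive_norm2_conformal a x : img (chart_of a) x ->
  derive_field (V a) (norm2 (g a) (V a)) x = 2 * rho a x * norm2 (g a) (V a) x.
Proof.
move=> ax; apply: (conformal_derive_norm2 (chart_metric_on a) (chart_field_on a) ax).
exact: conformal.
Qed.

Lemma metric_diag_gt0 a x i : img (chart_of a) x -> 0 < g a x i i.
Proof.
move=> ax; have := met_posdef g ax (v := basis_vec R i).
suff -> : \sum_j \sum_k g a x j k * basis_vec R i 0 j * basis_vec R i 0 k = g a x i i.
  apply; apply/eqP => /rowP/(_ i); rewrite !mxE !eqxx => /eqP.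
  by rewrite oner_eq0.
have E j k : g a x j k * basis_vec R i 0 j * basis_vec R i 0 k =
    g a x j k *+ (k == i) *+ (j == i).
  by rewrite !mxE eqxx /= !mulr_natr mulrnAC.
under eq_bigr do under eq_bigr do rewrite E.
under eq_bigr do rewrite sumrMnl sum_mulrb_eq.
exact: sum_mulrb_eq (fun j => g a x j i) i.
Qed.

Lemma factor_eq0 a x : img (chart_of a) x -> (\forall y \near x, V a y = 0) ->
  rho a x = 0.
Proof.
move=> ax V0; have i : 'I_n by exact: Ordinal n_gt0.
have := conformal ax i i; rewrite lie_metric0// => /esym/eqP.
rewrite !mulf_eq0 pnatr_eq0 /= (gt_eqF (metric_diag_gt0 i ax)) orbF => /eqP.
exact.
Qed.

Hypothesis locally_constant : forall a x, img (chart_of a) x ->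
  \forall y \near x, rho a y = rho a x.

(** Where [V] is nonzero, both factors are the ratio of [V(|V|^2)] to [2 |V|^2],
    which does not depend on the chart. If they differ at [p] they differ on a neighbourhood of [p], so
    that [V] vanishes there, and a conformal factor of the zero field is 0. *)
Lemma factor_neq a b (p : M) : dom (chart_of a) p -> dom (chart_of b) p ->
  rho a (coord (chart_of a) p) != rho b (coord (chart_of b) p) ->
  rho a (coord (chart_of a) p) = 0.
Proof.
move=> ap bp neq; apply: factor_eq0; first exact: coord_img.
have near_a := near_manifold ap (locally_constant (coord_img ap)).
have near_b := near_manifold bp (locally_constant (coord_img bp)).
have V0 : \forall q \near p, dom (chart_of a) q /\ V a (coord (chart_of a) q) = 0.
  apply: filterS2 near_a near_b => q [aq ra] [bq rb]; split => //.
  apply: norm2_eq0; first exact: coord_img.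
  have := derive_norm2_change aq bq.
  rewrite !derive_norm2_conformal ?ra ?rb; try exact: coord_img.
  rewrite -(transition_coord b aq) -norm2_change; last exact: overlap_coord.
  move=> /eqP; rewrite -subr_eq0 -mulrBl -mulrBr !mulf_eq0 pnatr_eq0 /= subr_eq0.
  by rewrite (negPf neq) => /eqP.
by apply: filterS (near_chart ap V0) => y [q [_ <- []]].
Qed.

Lemma factor_change a b (p : M) : dom (chart_of a) p -> dom (chart_of b) p ->
  rho a (coord (chart_of a) p) = rho b (coord (chart_of b) p).
Proof.
move=> ap bp; apply/eqP; apply: contraT => neq.
have ra := factor_neq ap bp neq; rewrite eq_sym in neq.
by move: (neq); rewrite ra (factor_neq bp ap neq) eqxx.
Qed.

Definition factor_support : set M :=
  [set p | exists2 a, dom (chart_of a) p & rho a (coord (chart_of a) p) != 0].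

Lemma factor_support_chart a p : dom (chart_of a) p ->
  factor_support p <-> rho a (coord (chart_of a) p) != 0.
Proof.
move=> ap; split=> [[b bp]|]; first by rewrite (factor_change ap bp).
by exists a.
Qed.

Lemma factor_support_near a p : dom (chart_of a) p ->
  \forall q \near p, factor_support q <-> factor_support p.
Proof.
move=> ap; apply: filterS (near_manifold ap (locally_constant (coord_img ap))) => q [aq E].
by rewrite (factor_support_chart aq) (factor_support_chart ap) E.
Qed.

Lemma factor_support_closed : closed factor_support.
Proof.
move=> p clp; have [a ap] := atlas_cover p.
have [q [sq sqp]] := clp _ (factor_support_near ap).
exact: sqp.1 sq.
Qed.

Definition chart_at (p : M) : chart_index M := sval (cid (atlas_cover p)).

Lemma chart_atP p : dom (chart_of (chart_at p)) p.
Proof. exact: svalP (cid (atlas_cover p)). Qed.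

Definition field_norm2 (p : M) : R :=
  norm2 (g (chart_at p)) (V (chart_at p)) (coord (chart_of (chart_at p)) p).

Lemma field_norm2E a p : dom (chart_of a) p ->
  field_norm2 p = norm2 (g a) (V a) (coord (chart_of a) p).
Proof.
move=> ap; have cp := chart_atP p.
rewrite /field_norm2 (norm2_change (overlap_coord cp ap)).
by rewrite transition_coord.
Qed.

Lemma field_norm2_continuous : continuous field_norm2.
Proof.
move=> p; have [a ap] := atlas_cover p; have ax := coord_img ap.
have nearE : \forall q \near p,
    norm2 (g a) (V a) (coord (chart_of a) q) = field_norm2 q.
  apply: filterS (open_nbhs_nbhs (conj (@dom_open _ _ _ (chart_of a)) ap)) => q aq.
  by rewrite (field_norm2E aq).
rewrite /continuous_at (field_norm2E ap).
apply: cvg_trans (near_eq_cvg nearE) _.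
apply: (@continuous_comp _ _ _ (coord (chart_of a)) (norm2 (g a) (V a))).
  exact: coord_cont.
apply: differentiable_continuous.
exact: (norm2_differentiable (chart_metric_on a) (chart_field_on a)).
Qed.

(** The support of [rho] is open and closed, hence compact, and [|V|^2] attains
    a maximum on it at some [p]. There [2 rho |V|^2 = V(|V|^2) = 0], so [V]
    vanishes on the whole support; as the support is open, [rho] vanishes at [p],
    which is absurd. *)
Lemma conformal_factor_eq0 : compact [set: M] ->
  forall a x, img (chart_of a) x -> rho a x = 0.
Proof.
move=> cM a x [p0 ap0 <-]; apply/eqP; apply: contraT => r0.
have A0 : factor_support !=set0 by exists p0; exists a.
have cA : compact factor_support := subclosed_compact factor_support_closed cM (@subsetT _ _).
have [p Ap maxp] := compact_EVT_max A0 cA (continuous_subspaceT field_norm2_continuous).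
rewrite inE in Ap; have [b bp rb] := Ap.
have Anear : \forall q \near p, factor_support q.
  by apply: filterS (factor_support_near bp) => q [_]; exact.
have xb := coord_img bp.
have max_chart k : partial k (norm2 (g b) (V b)) (coord (chart_of b) p) = 0.
  apply: derive_local_max; apply: filterS (near_chart bp Anear) => y [q [bq <- Aq]]; split.
    apply: diff_derivable.
    exact: (norm2_differentiable (chart_metric_on b) (chart_field_on b) (coord_img bq)).
  by rewrite -(field_norm2E bp) -(field_norm2E bq); apply: maxp; rewrite inE.
have N0 : norm2 (g b) (V b) (coord (chart_of b) p) = 0.
  have := derive_norm2_conformal xb.
  rewrite /derive_field big1 => [/esym/eqP|k _]; last by rewrite max_chart mulr0.
  by rewrite !mulf_eq0 pnatr_eq0 (negPf rb) => /eqP.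
case/eqP : rb; apply: factor_eq0 => //.
apply: filterS (near_chart bp Anear) => y [q [bq <- Aq]].
apply: norm2_eq0; first exact: coord_img.
apply/eqP; rewrite eq_le norm2_ge0 ?andbT; last exact: coord_img.
by rewrite -(field_norm2E bq) -N0 -(field_norm2E bp); apply: maxp; rewrite inE.
Qed.

End soliton_charts.

(** * The characterization of geodesic soliton fields *)

Lemma box_soliton (R : realType) (n : nat) (M : manifold R n)
    (g : riemannian_metric M) (V : vector_field M) (c : R) :
  (0 < n)%N -> yamabe_soliton g V c ->
  forall a x i, img (atlas M a) x ->
  box (g a) (V a) i x =
  (n%:R - 2) * \sum_b partial b (fun y => - c + scalar_curvature (g a) y) x
                      * gup (g a) b i x.
Proof.
move=> n0 [_ sol] a x i ax.
exact: (box_conformal (chart_metric_on g a) (chart_field_on V a) (sol a) n0).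
Qed.

(** If [box V = 0] the differential of [R] vanishes, as [n] is not 2 and the metric
    is nondegenerate. *)
Lemma geodesic_soliton_locally_constant (R : realType) (n : nat)
    (M : manifold R n) (g : riemannian_metric M) (V : vector_field M) (c : R) :
  (3 <= n)%N -> yamabe_soliton g V c -> geodesic_vector_field g V ->
  forall a x, img (atlas M a) x ->
  \forall y \near x, - c + scalar_curvature (g a) y = - c + scalar_curvature (g a) x.
Proof.
move=> n3 sol geo a x ax; have n0 : (0 < n)%N by exact: leq_trans n3.
have gU := chart_metric_on g a; have [oU _ _ ug] := gU.
apply: (partial0_locally_constant oU ax) => k y ay.
  exact: (conformal_factor_derivable gU (chart_field_on V a) (sol.2 a) n0 ay).
pose dr : 'rV[R]_n := \row_b partial b (fun z => - c + scalar_curvature (g a) z) y.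
suff dr0 : dr *m invmx (g a y) = 0.
  have /rowP/(_ k) : dr = 0 by rewrite -(mulmxKV (ug y ay) dr) dr0 mul0mx.
  by rewrite !mxE.
apply/rowP => i; rewrite [RHS]mxE.
have /eqP := geo a y ay i; rewrite (box_soliton n0 sol)// mulf_eq0.
have -> : (n%:R - 2 == 0 :> R) = false by rewrite subr_eq0 eqr_nat gtn_eqF.
by rewrite /= => /eqP <-; rewrite mxE; apply: eq_bigr => b _; rewrite mxE.
Qed.

Theorem theorem4p1 (R : realType) (n : nat) (M : manifold R n)
    (g : riemannian_metric M) (V : vector_field M) (c : R) :
  (3 <= n)%N ->
  compact [set: M] ->
  yamabe_soliton g V c ->
  (geodesic_vector_field g V <-> constant_scalar_curvature g).
Proof.
move=> n3 cM sol; have n0 : (0 < n)%N by exact: leq_trans n3.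
split=> [geo|[k Rk] a x ax i].
  exists c => a x ax.
  have lc := geodesic_soliton_locally_constant n3 sol geo.
  have /eqP := conformal_factor_eq0 sol.2 n0 lc cM ax.
  by rewrite addrC subr_eq0 => /eqP.
rewrite (box_soliton n0 sol)// big1 ?mulr0// => b _.
have -> : partial b (fun y => - c + scalar_curvature (g a) y) x = 0.
  transitivity (partial b (cst (- c + k)) x); last exact: derive_cst.
  apply: near_eq_derive.
  have near_img := open_nbhs_nbhs (conj (@img_open _ _ _ (atlas M a)) ax).
  by apply: filterS near_img => y ay; rewrite Rk.
exact: mul0r.
Qed.
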